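(* Let $\lambda\ge1$ and $p\ge1$ be integers. Consider a randomized $p$-pass streaming algorithm that is given as input an integer $\kappa$, followed by a stream of edges of an $n$-vertex multigraph $\hat G$ whose underlying simple graph $G$ has degeneracy $\kappa(G)=\kappa$, and that (with probability at least $2/3$) produces a proper $(\kappa+\lambda)$-coloring of $G$. Such an algorithm requires $\Omega(n^2/(\lambda^2 p))$ bits of space. This holds even if the stream is insertion-only with each edge appearing at most twice.
   Context: The degeneracy $\kappa(G)$ is the least $k$ such that every induced subgraph of $G$ has a vertex of degree at most $k$. The underlying simple graph of a multigraph has an edge $\{u,v\}$ iff the multigraph has at least one copy of it. A $p$-pass algorithm reads the same stream $p$ times in order. *)

(* Defs.v *)
From mathcomp Require Import all_boot all_order all_algebra.

Set Implicit Arguments.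
Unset Strict Implicit.
Unset Printing Implicit Defensive.

Section Graphs.
Variable T : finType.
Implicit Type g : rel T.

(* Induced subgraphs are taken on nonempty vertex sets [S]. *)
Definition degenerate g (k : nat) : bool :=
  [forall S : {set T}, (S != set0) ==>
    [exists v in S, #|[set u in S | g v u]| <= k]].

Lemma degenerate_ex g : exists k, degenerate g k.
Proof.
exists #|T|; apply/forallP => S; apply/implyP => /set0Pn[v vS].
by apply/existsP; exists v; rewrite vS max_card.
Qed.

Definition degeneracy g : nat := ex_minn (degenerate_ex g).

Definition proper_coloring g (k : nat) (f : T -> nat) : Prop :=
  (forall v, f v < k) /\ (forall u v, g u v -> f u <> f v).

End Graphs.

Section Streams.
Variable n : nat.

Definition edge : Type := {e : {set 'I_n} | #|e| == 2}.

(* [(true, e)] inserts one copy of [e], [(false, e)] deletes one copy. *)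
Definition token : Type := (bool * edge)%type.

Definition ins (st : seq token) (e : edge) : nat := count_mem (true, e) st.
Definition del (st : seq token) (e : edge) : nat := count_mem (false, e) st.

(* Copies are deleted only while present, so that the truncated subtraction
   in [mult] is exact on such streams. *)
Definition multigraph_stream (st : seq token) : Prop :=
  forall (i : nat) (e : edge), del (take i st) e <= ins (take i st) e.

Definition insertion_only (st : seq token) : Prop :=
  forall e : edge, del st e = 0.

Definition at_most_twice (st : seq token) : Prop :=
  forall e : edge, ins st e <= 2.

Definition mult (st : seq token) (e : edge) : nat := ins st e - del st e.

Definition underlying (st : seq token) : rel 'I_n :=
  fun u v => [exists e : edge, (0 < mult st e) && (val e == [set u; v])].

End Streams.

(* Algorithms on [n]-vertex streams with [s] bits of memory, driven by a random
   outcome [w : W]. The number [kappa], the pass number, the position in the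
   stream and the whole outcome [w] can be consulted without being stored in
   memory; as [w] can contain an independent block of coins for every (pass,
   position), coins tossed on the fly are included. The colouring is computed
   from the memory left after the last pass. *)
Record streaming_algorithm (W : Type) (n s : nat) := StreamingAlgorithm {
  sa_init : W -> nat -> s.-tuple bool;
  (* outcome, kappa, pass, position, token, memory *)
  sa_step : W -> nat -> nat -> nat -> token n -> s.-tuple bool -> s.-tuple bool;
  sa_out : W -> nat -> s.-tuple bool -> 'I_n -> nat
}.

Section Run.
Variables (W : Type) (n s : nat) (A : streaming_algorithm W n s).
Variables (w : W) (kappa : nat) (st : seq (token n)).

Definition run_pass (i : nat) (m : s.-tuple bool) : s.-tuple bool :=
  foldl (fun m jt => sa_step A w kappa i jt.1 jt.2 m) m
        (zip (iota 0 (size st)) st).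

Definition run (p : nat) : 'I_n -> nat :=
  sa_out A w kappa
    (foldl (fun m i => run_pass i m) (sa_init A w kappa) (iota 0 p)).

End Run.

From mathcomp Require Import all_classical all_reals all_analysis.

Local Open Scope classical_set_scope.
Local Open Scope ring_scope.

Definition success (W : Type) (n s : nat) (A : streaming_algorithm W n s)
    (p lambda : nat) (st : seq (token n)) : set W :=
  let g := underlying st in
  let kappa := degeneracy g in
  [set w | proper_coloring g (kappa + lambda)%N (run A w kappa st p)].

(* [A], run with [p] passes, colours every input from the class [Q] with
   probability at least 2/3. *)
Definition solves (R : realType) (d : measure_display) (W : measurableType d)
    (P : probability W R) (n s : nat) (A : streaming_algorithm W n s)
    (p lambda : nat) (Q : seq (token n) -> Prop) : Prop :=
  forall st, Q st ->
    measurable (success A p lambda st) /\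
    ((2 / 3)%:E <= P (success A p lambda st))%E.

(* Main.v *)
Require Import Defs.
From mathcomp Require Import all_boot all_order all_algebra.
From mathcomp Require Import all_classical all_reals all_analysis.
From mathcomp Require Import measurable_realfun finset ring lra zify.

(* The proof is a reduction from finding the common element of two sets [A] and
   [B] with [A :&: B = [set z]].  Take [k] left and [k] right blocks of [lambda]
   vertices, where [k] is about [n / (3 * lambda)]; the sets consist of pairs of
   a left and a right block.  Alice inserts the edges between the block pairs
   outside [A], Bob those outside [B] and all other edges.  The union is the
   complete graph minus one biclique [K_(lambda, lambda)], of degeneracy
   [n - lambda - 1]; in a proper colouring with [n - 1] colours two vertices
   share a colour, and they reveal [z].

   The search problem on [N = k^2] elements needs [Omega(N)] bits of
   communication by the information complexity argument for disjointness.  The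
   two players can check [z], so for a fixed random outcome the transcripts
   partition the inputs into rectangles [f l * g l], and those that succeed
   contain no disjoint pair.  Each element of the ground set is given to one of
   the players, who keeps it with probability 1/2.  The entropy of the
   transcript bounds, summed over the elements [i], the squared Hellinger
   distances between the transcript distributions for [(A_i, B_i) = (0, 0)] and
   for (1, 0) or (0, 1); cut-and-paste turns this into a bound for the distance
   between (0, 0) and (1, 1), which is at least the success probability. *)

Set Implicit Arguments.
Unset Strict Implicit.
Unset Printing Implicit Defensive.

Import Order.TTheory GRing.Theory Num.Theory.

Local Open Scope ring_scope.

(** * Entropy and the squared Hellinger distance *)

Section Entropy.
Variable R : realType.
Implicit Types x y z t : R.

Definition xlnx x : R := x * ln x.

Definition sqhell x y : R := (Num.sqrt x - Num.sqrt y) ^+ 2.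

Lemma sqhellE x y : 0 <= x -> 0 <= y ->
  sqhell x y = x + y - 2 * (Num.sqrt x * Num.sqrt y).
Proof.
move=> x0 y0; rewrite /sqhell sqrrB !sqr_sqrtr// -mulr_natl.
by rewrite mulr_natl; ring.
Qed.

Lemma sqhell_ge0 x y : 0 <= sqhell x y. Proof. exact: sqr_ge0. Qed.

Lemma sqhellZ z x y : 0 <= z -> 0 <= x -> sqhell (z * x) (z * y) = z * sqhell x y.
Proof.
move=> z0 x0; rewrite /sqhell !sqrtrM// -mulrBr exprMn sqr_sqrtr//.
Qed.

(** Joint convexity, by Cauchy-Schwarz on the square roots. *)
Lemma sqhell_midpoint x1 x2 y1 y2 : 0 <= x1 -> 0 <= x2 -> 0 <= y1 -> 0 <= y2 ->
  sqhell ((x1 + x2) / 2) ((y1 + y2) / 2) <= (sqhell x1 y1 + sqhell x2 y2) / 2.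
Proof.
move=> x10 x20 y10 y20.
rewrite !sqhellE ?divr_ge0 ?addr_ge0//.
suff : Num.sqrt x1 * Num.sqrt y1 + Num.sqrt x2 * Num.sqrt y2
  <= 2 * (Num.sqrt ((x1 + x2) / 2) * Num.sqrt ((y1 + y2) / 2)) by lra.
rewrite -ler_sqr ?nnegrE ?addr_ge0 ?mulr_ge0 ?sqrtr_ge0//.
rewrite !exprMn !sqr_sqrtr ?divr_ge0 ?addr_ge0//.
rewrite sqrrD !exprMn !sqr_sqrtr//.
have := sqr_ge0 (Num.sqrt x1 * Num.sqrt y2 - Num.sqrt x2 * Num.sqrt y1).
rewrite sqrrB !exprMn !sqr_sqrtr//; lra.
Qed.

(** This is [ln r <= r - 1] at [r = sqrt (m / x)], multiplied by [2 * x]. *)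
Lemma xlnx_ge_sqrt x m : 0 <= x -> 0 < m ->
  2 * x - 2 * (Num.sqrt x * Num.sqrt m) + x * ln m <= xlnx x.
Proof.
move=> x0 m0; have [->|xn0] := eqVneq x 0.
  by rewrite /xlnx sqrtr0 !mul0r !mulr0; lra.
have {}x0 : 0 < x by rewrite lt_neqAle eq_sym xn0.
pose r := Num.sqrt m / Num.sqrt x.
have r0 : 0 < r by rewrite divr_gt0 ?sqrtr_gt0.
have lnr : ln r *+ 2 = ln m - ln x.
  rewrite -lnXn// exprMn exprVn !sqr_sqrtr ?ltW//.
  by rewrite ln_div// posrE.
have /le_ln1Dx : -1 < r - 1 by lra.
rewrite addrCA subrr addr0 => lr.
have : x * (ln r *+ 2) <= x * ((r - 1) *+ 2).
  by rewrite ler_pM2l// !mulr2n; lra.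
have -> : x * ((r - 1) *+ 2) = 2 * (Num.sqrt x * Num.sqrt m) - 2 * x.
  have sx0 : Num.sqrt x != 0 by rewrite gt_eqF// sqrtr_gt0.
  rewrite /r -{1 4}(sqr_sqrtr (ltW x0)); field; exact: sx0.
rewrite lnr /xlnx mulrBr; lra.
Qed.

(** The convexity gap dominates a Hellinger term: apply [xlnx_ge_sqrt] to [x] and to [y] with [m]
    their midpoint; what remains is the square of [sqrt x + sqrt y - 2 * sqrt m]. *)
Lemma xlnx_midpoint x y : 0 <= x -> 0 <= y ->
  xlnx ((x + y) / 2) + sqhell x y / 4 <= (xlnx x + xlnx y) / 2.
Proof.
move=> x0 y0; set m := (x + y) / 2.
have m0 : 0 <= m by rewrite divr_ge0 ?addr_ge0.
have [m00|mn0] := eqVneq m 0.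
  have [-> ->] : x = 0 /\ y = 0 by move: m00; rewrite /m; split; lra.
  by rewrite m00 /xlnx /sqhell !mul0r subrr expr0n/=; lra.
have {}m0 : 0 < m by rewrite lt_neqAle eq_sym mn0.
have := xlnx_ge_sqrt x0 m0; have := xlnx_ge_sqrt y0 m0.
have : x + y = 2 * m by rewrite /m; lra.
have := sqr_ge0 (Num.sqrt x + Num.sqrt y - 2 * Num.sqrt m).
rewrite [xlnx m]/xlnx sqhellE//.
have := sqr_sqrtr (ltW m0); have := sqr_sqrtr x0; have := sqr_sqrtr y0.
set a := Num.sqrt x; set b := Num.sqrt y; set c := Num.sqrt m.
move=> hb ha hc hs xym.
have -> : m * ln m = (x * ln m + y * ln m) / 2 by rewrite -mulrDl xym; field.
have : (a + b - 2 * c) ^+ 2 =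
  a ^+ 2 + b ^+ 2 + 4 * c ^+ 2 + 2 * (a * b) - 4 * (a * c) - 4 * (b * c) by ring.
move: hs => /[swap] ->; rewrite ha hb hc; lra.
Qed.

(** Gibbs' inequality against the uniform distribution: [ln r <= r - 1] at [r = 1 / (q l * #|T|)],
    where the errors [#|T|^-1 - q l] sum to 0. *)
Lemma sum_xlnx_ge (T : finType) (q : T -> R) : (forall l, 0 <= q l) ->
  \sum_l q l = 1 -> \sum_l - xlnx (q l) <= ln #|T|%:R.
Proof.
move=> q0 q1.
have T0 : (0 < #|T|)%N.
  case: posnP => // /eqP/pred0P T0; move: q1.
  by rewrite big1 => [/eqP|l]; [rewrite eq_sym oner_eq0|have := T0 l].
have L0 : 0 < #|T|%:R :> R by rewrite ltr0n.
have key l : - xlnx (q l) <= q l * ln #|T|%:R + #|T|%:R^-1 - q l.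
  have [->|qn0] := eqVneq (q l) 0.
    by rewrite /xlnx !mul0r oppr0 add0r addr0 invr_ge0 ltW.
  have ql : 0 < q l by rewrite lt_neqAle eq_sym qn0 q0.
  have r0 : 0 < (q l * #|T|%:R)^-1 by rewrite invr_gt0 mulr_gt0.
  have /le_ln1Dx : -1 < (q l * #|T|%:R)^-1 - 1 by lra.
  rewrite addrCA subrr addr0 lnV ?posrE ?mulr_gt0// lnM ?posrE// => h.
  have : q l * - (ln (q l) + ln #|T|%:R) <= q l * ((q l * #|T|%:R)^-1 - 1).
    by rewrite ler_pM2l.
  rewrite mulrBr invfM mulrA mulfV// mul1r mulr1 /xlnx mulrN mulrDr; lra.
apply: (le_trans (ler_sum _ (fun l _ => key l))).
rewrite sumrB big_split/= -mulr_suml q1 mul1r sumr_const.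
by rewrite -[_^-1 *+ _]mulr_natr mulVf ?gt_eqF// addrK.
Qed.

End Entropy.

(** * Averages over a uniformly random subset *)

Section Mean.
Variables (R : realType) (I : finType).
Implicit Types (v X : {set I}) (f : {set I} -> R) (i j : I).

Definition mean v f : R := 2^-1 ^+ #|v| * \sum_(X : {set I} | X \subset v) f X.

(** On subsets of [v :\ i], [f] is the restriction to coordinate [i] equal to 0 and [setU1_fun i f]
    the one to coordinate [i] equal to 1. *)
Definition setU1_fun i f : {set I} -> R := fun X => f (i |: X).

Lemma eq_mean v f g : (forall X, X \subset v -> f X = g X) -> mean v f = mean v g.
Proof. by move=> fg; rewrite /mean (eq_bigr _ fg). Qed.

Lemma mean_ge0 v f : (forall X, 0 <= f X) -> 0 <= mean v f.
Proof. by move=> f0; rewrite mulr_ge0 ?exprn_ge0 ?invr_ge0// sumr_ge0. Qed.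

Lemma mean_cst v c : mean v (fun=> c) = c.
Proof.
rewrite /mean (eq_bigl (mem (powerset v))) => [|X]; last by rewrite /= powersetE.
rewrite sumr_const card_powerset.
by rewrite -[c *+ _]mulr_natl natrX mulrA -exprMn mulVf// expr1n mul1r.
Qed.

Lemma mean0 f : mean set0 f = f set0.
Proof.
rewrite /mean cards0 expr0 mul1r (big_pred1 set0)// => X.
by rewrite subset0.
Qed.

Lemma meanZl v c f : mean v (fun X => c * f X) = c * mean v f.
Proof. by rewrite /mean -mulr_sumr mulrCA. Qed.

Lemma mean_sum (T : finType) (Q : pred T) v (F : T -> {set I} -> R) :
  mean v (fun X => \sum_(l | Q l) F l X) = \sum_(l | Q l) mean v (F l).
Proof. by rewrite /mean exchange_big mulr_sumr. Qed.

Lemma mean_prod v v' f g :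
  mean v f * mean v' g = mean v (fun X => mean v' (fun Y => f X * g Y)).
Proof.
rewrite mulrC -meanZl; apply: eq_mean => X _.
by rewrite meanZl mulrC.
Qed.

Lemma meanD1 i v f : i \in v ->
  mean v f = (mean (v :\ i) f + mean (v :\ i) (setU1_fun i f)) / 2.
Proof.
move=> iv; rewrite /mean (cardsD1 i v) iv exprS -mulrDr.
rewrite (bigID (fun X : {set I} => i \in X))/= addrC.
rewrite [X in _ = _ * (X + _) / 2](_ : _ =
    \sum_(X : {set I} | (X \subset v) && (i \notin X)) f X); last first.
  by apply: eq_bigl => X; rewrite subsetD1.
rewrite [X in _ = _ * (_ + X) / 2](_ : _ =
    \sum_(X : {set I} | (X \subset v) && (i \in X)) f X); last first.
  rewrite [RHS](reindex_onto (fun X => i |: X) (fun X => X :\ i)) /=.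
    apply: eq_bigl => X; rewrite subUset sub1set iv setU11 andbT/= subsetD1.
    apply/andP/andP => -[Xv]; first by move=> iX; rewrite setU1K// eqxx.
    by move=> /eqP XE; split=> //; rewrite -XE !inE eqxx.
  by move=> X /andP[_ iX]; rewrite setD1K.
by ring.
Qed.

Lemma setU1_funC i j f : setU1_fun i (setU1_fun j f) = setU1_fun j (setU1_fun i f).
Proof. by apply: funext => X; rewrite /setU1_fun setUCA. Qed.

(* Subadditivity of entropy, in the form of a Hellinger bound on the influences
   of the single coordinates. *)
Lemma xlnx_mean_le v f : (forall X, f X = 0 \/ f X = 1) ->
  xlnx (mean v f) +
    (\sum_(j in v) sqhell (mean (v :\ j) f) (mean (v :\ j) (setU1_fun j f))) / 4 <= 0.
Proof.
move: {2}#|v| (erefl #|v|) => n; elim: n v f => [|n IH] v f vn f01.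
  have -> : v = set0 by apply/eqP; rewrite -cards_eq0 vn.
  rewrite mean0 big_set0 mul0r addr0 /xlnx.
  by case: (f01 set0) => ->; rewrite ?mul0r// ln1 mulr0.
have f0 X : 0 <= f X by case: (f01 X) => ->.
have [i iv] : exists i, i \in v by apply/set0Pn; rewrite -cards_eq0 vn.
have vin : #|v :\ i| = n by move: vn; rewrite (cardsD1 i) iv => -[].
have := IH _ _ vin f01.
have := IH _ (setU1_fun i f) vin (fun X => f01 _).
rewrite (meanD1 f iv) (big_setD1 i iv)/=.
have s0 k X : 0 <= setU1_fun k f X by rewrite /setU1_fun.
have := xlnx_midpoint (mean_ge0 (v :\ i) f0) (mean_ge0 (v :\ i) (s0 i)).
set S1 := \sum_(j in v :\ i) _; set S2 := \sum_(j in v :\ i) _.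
set S := \sum_(j in v :\ i) _.
(* [xlnx_midpoint] has paid for coordinate [i]; for the other [j], averaging over [i] can only
   decrease the Hellinger term, by joint convexity. *)
suff : S <= (S1 + S2) / 2 by lra.
rewrite /S1 /S2 -big_split /= mulr_suml; apply: ler_sum => j.
rewrite !inE => /andP[ji jv].
have ivj : i \in v :\ j by rewrite !inE eq_sym ji.
rewrite (meanD1 f ivj) (meanD1 (setU1_fun j f) ivj).
have -> : v :\ j :\ i = v :\ i :\ j by apply/setP=> x; rewrite !inE andbCA.
rewrite [sqhell (mean _ (setU1_fun i f)) _ + _]addrC setU1_funC.
by apply: sqhell_midpoint; apply: mean_ge0 => X; exact: f0.
Qed.

End Mean.

(** * Two-party communication as partitions into rectangles *)

Section Rectangles.
Variable S : Type.

(** A deterministic protocol is reduced to its leaves: [L] combinatorial rectangles that partition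
    the inputs, each labelled by the value of [F] on it. *)
Definition rect_computes (X : Type) (F : S -> S -> X) (L : nat) : Prop :=
  exists (T : finType) (f g : T -> pred S) (lab : T -> X), #|T| = L /\
    forall A B, exists l0, lab l0 = F A B /\
      forall l, f l A && g l B = (l == l0).

Lemma rect_computes_cst (X : Type) (x : X) : rect_computes (fun _ _ => x) 1.
Proof.
exists unit, (fun _ => xpredT), (fun _ => xpredT), (fun _ => x).
by rewrite card_unit; split=> // A B; exists tt; split=> // -[].
Qed.

Lemma rect_computes_map (X Y : Type) (h : X -> Y) F L :
  rect_computes F L -> rect_computes (fun A B => h (F A B)) L.
Proof.
move=> [T [f [g [lab [TL FP]]]]]; exists T, f, g, (h \o lab); split=> // A B.
by have [l0 [labE ?]] := FP A B; exists l0; rewrite /= labE.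
Qed.

(** Alice sends a message in [Y] that depends on her input and on the value known to both; this cuts
    each leaf along her side only, so the pieces stay rectangles. *)
Lemma rect_computes_alice (X : Type) (Y : finType) (a : S -> X -> Y) F L :
  rect_computes F L ->
  rect_computes (fun A B => (F A B, a A (F A B))) (L * #|Y|).
Proof.
move=> [T [f [g [lab [TL FP]]]]].
exists (T * Y)%type, (fun l A => f l.1 A && (a A (lab l.1) == l.2)).
exists (fun l => g l.1), (fun l => (lab l.1, l.2)).
rewrite card_prod TL; split=> // A B; have [l0 [labE lP]] := FP A B.
exists (l0, a A (F A B)); rewrite /= labE; split=> // -[l y] /=.
rewrite andbAC lP xpair_eqE; case: eqP => //= ->.
by rewrite labE eq_sym.
Qed.

Lemma rect_computes_swap (X : Type) (F : S -> S -> X) L :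
  rect_computes F L -> rect_computes (fun A B => F B A) L.
Proof.
move=> [T [f [g [lab [TL FP]]]]]; exists T, g, f, lab; split=> // A B.
have [l0 [labE lP]] := FP B A; exists l0; split=> // l.
by rewrite andbC.
Qed.

Lemma rect_computes_bob (X : Type) (Y : finType) (b : S -> X -> Y) F L :
  rect_computes F L ->
  rect_computes (fun A B => (F A B, b B (F A B))) (L * #|Y|).
Proof.
move=> /rect_computes_swap/(rect_computes_alice b).
exact: rect_computes_swap.
Qed.

End Rectangles.

(** * Information cost of finding a unique common element *)

Section UniqueIntersection.
Variables (R : realType) (I : finType).
Implicit Types (v A B : {set I}) (i : I).

Lemma xlnxM (x y : R) : 0 <= x -> 0 <= y ->
  xlnx (x * y) = y * xlnx x + x * xlnx y.
Proof.
rewrite le_eqVlt => /predU1P[<-|x0]; first by rewrite /xlnx !mul0r mulr0 addr0.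
rewrite le_eqVlt => /predU1P[<-|y0]; first by rewrite /xlnx !mulr0 !mul0r mulr0 addr0.
by rewrite /xlnx lnM ?posrE//; ring.
Qed.

Definition flip i v : {set I} := if i \in v then v :\ i else i |: v.

Lemma flipK i : involutive (flip i).
Proof.
move=> v; rewrite /flip; case iv: (i \in v).
  by rewrite setD11 setD1K.
by rewrite setU11 setU1K// iv.
Qed.

Lemma in_flip i v : (i \in flip i v) = (i \notin v).
Proof. by rewrite /flip; case: ifP => iv; rewrite !inE eqxx. Qed.

Lemma flipD1 i v : flip i v :\ i = v :\ i.
Proof.
apply/setP => x; rewrite /flip; case: ifP => iv; rewrite !inE;
by case: (x == i).
Qed.

Lemma flipC i v : ~: flip i v = flip i (~: v).
Proof.
apply/setP => x; rewrite /flip inE; case: ifP => iv; rewrite !inE iv/=.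
  by rewrite !inE; case: eqVneq => //= ->.
by rewrite !inE; case: eqVneq => //= ->.
Qed.

(** With [v] the set of elements given to Alice, [flip i] changes the owner of [i]. Pairing [v] with
    [flip i v] lets the owner alone decide which of the two terms is charged. *)
Lemma sum_flip i (P Q : {set I} -> R) :
  (forall v, P (flip i v) = P v) -> (forall v, Q (flip i v) = Q v) ->
  \sum_(v : {set I}) (P v + Q v) = 2 * \sum_(v : {set I}) (if i \in v then P v else Q v).
Proof.
move=> hP hQ; rewrite mulr_natl mulr2n.
rewrite [X in _ = X + _](reindex_inj (inv_inj (@flipK i))) /= -big_split.
apply: eq_bigr => v _; rewrite in_flip hP hQ.
by case: (i \in v) => //=; rewrite addrC.
Qed.

(** For a fixed allocation [v], the probability of a leaf is a product of one factor per player;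
    [xlnxM] splits its entropy term, and [xlnx_mean_le] bounds each part. *)
Lemma sum_if_sqhell (f g : {set I} -> R) v :
  (forall X, f X = 0 \/ f X = 1) -> (forall X, g X = 0 \/ g X = 1) ->
  \sum_i (if i \in v then
      mean (~: v :\ i) g * sqhell (mean (v :\ i) f) (mean (v :\ i) (setU1_fun i f))
    else
      mean (v :\ i) f * sqhell (mean (~: v :\ i) g) (mean (~: v :\ i) (setU1_fun i g)))
  <= 4 * - xlnx (mean v f * mean (~: v) g).
Proof.
move=> f01 g01.
have f0 : 0 <= mean v f by apply: mean_ge0 => X; case: (f01 X) => ->.
have g0 : 0 <= mean (~: v) g by apply: mean_ge0 => X; case: (g01 X) => ->.
have D1 (w : {set I}) i : i \notin w -> w :\ i = w.
  move=> iw; apply/setP => x; rewrite !inE; case: eqVneq => //= ->.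
  by rewrite (negbTE iw).
rewrite (bigID (mem v))/=.
under eq_bigr => i iv do rewrite iv D1 ?inE ?iv//.
rewrite -mulr_sumr.
under [X in _ + X <= _]eq_bigr => i iv do rewrite (negbTE iv) D1//.
rewrite -mulr_sumr xlnxM//.
rewrite [X in _ + _ * X <= _](eq_bigl (mem (~: v))); last by move=> i; rewrite !inE.
have := xlnx_mean_le v f01; have := xlnx_mean_le (~: v) g01.
set Sf := \sum_(j in v) _; set Sg := \sum_(j in ~: v) _ => hg hf.
have : mean (~: v) g * Sf <= mean (~: v) g * (4 * - xlnx (mean v f)).
  by apply: ler_wpM2l => //; lra.
have : mean v f * Sg <= mean v f * (4 * - xlnx (mean (~: v) g)).
  by apply: ler_wpM2l => //; lra.
lra.
Qed.

(* [a_x l * b_y l] is the probability of leaf [l] when one coordinate of the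
   input is fixed to (x, y); the product form makes the Hellinger distance
   between (0,0) and (1,1) equal to the one between (1,0) and (0,1). *)
Lemma cut_and_paste (T : finType) (a0 a1 b0 b1 : T -> R) :
  (forall l, 0 <= a0 l) -> (forall l, 0 <= a1 l) ->
  (forall l, 0 <= b0 l) -> (forall l, 0 <= b1 l) ->
  \sum_l a0 l * b0 l = 1 -> \sum_l a0 l * b1 l = 1 ->
  \sum_l a1 l * b0 l = 1 -> \sum_l a1 l * b1 l = 1 ->
  \sum_l sqhell (a0 l * b0 l) (a1 l * b1 l) <=
    2 * \sum_l (b0 l * sqhell (a0 l) (a1 l) + a0 l * sqhell (b0 l) (b1 l)).
Proof.
move=> a00 a10 b00 b10 s00 s01 s10 s11.
have -> : \sum_l sqhell (a0 l * b0 l) (a1 l * b1 l) =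
          \sum_l sqhell (a1 l * b0 l) (a0 l * b1 l).
  under eq_bigr do rewrite sqhellE ?mulr_ge0// !sqrtrM// mulrACA.
  under [RHS]eq_bigr do rewrite sqhellE ?mulr_ge0// !sqrtrM// mulrACA.
  rewrite !sumrB !big_split/= s00 s01 s10 s11; congr (_ - _).
  by apply: eq_bigr => l _; rewrite [Num.sqrt (a0 l) * _]mulrC.
rewrite mulr_sumr; apply: ler_sum => l _.
rewrite -!sqhellZ// /sqhell [b0 l * _]mulrC [b0 l * _]mulrC.
set x := Num.sqrt (a1 l * b0 l); set y := Num.sqrt (a0 l * b1 l).
set z := Num.sqrt (a0 l * b0 l).
(* Parallelogram law for [x - z] and [y - z]. *)
have := sqr_ge0 (x + y - 2 * z); nra.
Qed.

(** The random inputs [i |: A] and [i |: B] meet in [i] alone. The factor 16 is 2 from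
    [cut_and_paste], 2 from [sum_flip] and 4 from [sum_if_sqhell]; [2 ^+ #|I|] counts the
    allocations [v]. *)
Lemma unique_intersection_bound (F : {set I} -> {set I} -> bool) L :
  rect_computes F L ->
  (forall A B, [disjoint A & B] -> F A B = false) ->
  \sum_i \sum_(v : {set I}) mean (v :\ i) (fun A =>
      mean (~: v :\ i) (fun B => (F (i |: A) (i |: B))%:R)) <=
    16 * 2 ^+ #|I| * ln L%:R :> R.
Proof.
move=> [T [f [g [lab [TL FP]]]]] Fdisj.
pose fR l X : R := (f l X)%:R; pose gR l X : R := (g l X)%:R.
have fR01 l X : fR l X = 0 \/ fR l X = 1 by rewrite /fR; case: (f l X); [right|left].
have gR01 l X : gR l X = 0 \/ gR l X = 1 by rewrite /gR; case: (g l X); [right|left].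
have fR0 l X : 0 <= fR l X by rewrite /fR.
have gR0 l X : 0 <= gR l X by rewrite /gR.
have leaf1 A B : \sum_l fR l A * gR l B = 1.
  have [l0 [_ lP]] := FP A B.
  rewrite (bigD1 l0)//= big1 => [|l /negbTE ln].
    by rewrite addr0 /fR /gR -natrM mulnb lP eqxx.
  by rewrite /fR /gR -natrM mulnb lP ln.
have leafF A B : \sum_(l | lab l) fR l A * gR l B = (F A B)%:R.
  have [l0 [lF lP]] := FP A B; rewrite -lF big_mkcond/= (bigD1 l0)//=.
  rewrite big1 => [|l /negbTE ln].
    by rewrite addr0 /fR /gR -natrM mulnb lP eqxx; case: (lab l0).
  by rewrite /fR /gR -natrM mulnb lP ln; case: (lab l).
have sum1 v v' (h h' : {set I} -> {set I}) :
    \sum_l mean v (fR l \o h) * mean v' (gR l \o h') = 1.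
  under eq_bigr do rewrite mean_prod.
  rewrite -mean_sum -[RHS](mean_cst v); apply: eq_mean => X _.
  by rewrite -mean_sum -[RHS](mean_cst v'); apply: eq_mean => Y _; exact: leaf1.
pose a0 i v l := mean (v :\ i) (fR l).
pose a1 i v l := mean (v :\ i) (setU1_fun i (fR l)).
pose b0 i v l := mean (~: v :\ i) (gR l).
pose b1 i v l := mean (~: v :\ i) (setU1_fun i (gR l)).
pose P i v l := b0 i v l * sqhell (a0 i v l) (a1 i v l).
pose Q i v l := a0 i v l * sqhell (b0 i v l) (b1 i v l).
have stepA i v : mean (v :\ i) (fun A =>
      mean (~: v :\ i) (fun B => (F (i |: A) (i |: B))%:R))
    <= 2 * \sum_l (P i v l + Q i v l).
  apply: le_trans (cut_and_paste _ _ _ _ _ _ _ _); last 8 first.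
  - by move=> l; apply: mean_ge0.
  - by move=> l; apply: mean_ge0 => X; exact: fR0.
  - by move=> l; apply: mean_ge0.
  - by move=> l; apply: mean_ge0 => X; exact: gR0.
  - exact: (sum1 _ _ id id).
  - exact: (sum1 _ _ id (fun X => i |: X)).
  - exact: (sum1 _ _ (fun X => i |: X) id).
  - exact: (sum1 _ _ (fun X => i |: X) (fun X => i |: X)).
  have -> : mean (v :\ i) (fun A =>
      mean (~: v :\ i) (fun B => (F (i |: A) (i |: B))%:R)) =
      \sum_(l | lab l) a1 i v l * b1 i v l.
    rewrite [RHS](eq_bigr _ (fun l _ => mean_prod _ _ _ _)) -mean_sum.
    apply: eq_mean => X _; rewrite -mean_sum; apply: eq_mean => Y _.
    by rewrite -leafF.
  (* An accepting leaf contains no disjoint pair, so its (0,0) mass is 0 and its Hellinger term is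
     its whole (1,1) mass; rejecting leaves are dropped. *)
  rewrite [leRHS](bigID lab)/= -[leLHS]addr0; apply: lerD; last first.
    by apply: sumr_ge0 => l _; exact: sqhell_ge0.
  apply: ler_sum => l labl; suff -> : a0 i v l * b0 i v l = 0.
    rewrite /sqhell sqrtr0 sub0r sqrrN sqr_sqrtr//.
    by apply: mulr_ge0; apply: mean_ge0 => X; [exact: fR0|exact: gR0].
  rewrite mean_prod -[RHS](mean_cst (v :\ i)); apply: eq_mean => X Xv.
  rewrite -[RHS](mean_cst (~: v :\ i)); apply: eq_mean => Y Yv.
  have XY : [disjoint X & Y].
    rewrite -setI_eq0; apply/eqP/setP => x; rewrite !inE.
    apply/negbTE/negP => /andP[/(fintype.subsetP Xv) + /(fintype.subsetP Yv)].
    by rewrite !inE => /andP[_ ->]; rewrite andbF.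
  have [l0 [lF lP]] := FP X Y.
  rewrite /fR /gR -natrM mulnb lP; case: eqP => // ll0.
  by move: labl; rewrite ll0 lF Fdisj.
apply: (le_trans (ler_sum _ (fun i _ => ler_sum _ (fun v _ => stepA i v)))).
have -> : \sum_i \sum_(v : {set I}) 2 * \sum_l (P i v l + Q i v l) =
   4 * \sum_l \sum_(v : {set I}) \sum_i (if i \in v then P i v l else Q i v l).
  under eq_bigr do rewrite -mulr_sumr exchange_big/=.
  rewrite -mulr_sumr exchange_big/= !mulr_sumr; apply: eq_bigr => l _.
  rewrite [X in _ = 4 * X]exchange_big/= !mulr_sumr; apply: eq_bigr => i _.
  rewrite (@sum_flip i (P i ^~ l) (Q i ^~ l)); first by ring.
  - by move=> v; rewrite /P /b0 /a0 /a1 flipC !flipD1.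
  - by move=> v; rewrite /Q /b0 /a0 /b1 flipC !flipD1.
have -> : 16 * 2 ^+ #|I| * ln L%:R = 4 * \sum_(v : {set I}) (4 * ln L%:R) :> R.
  rewrite sumr_const (_ : #|_| = 2 ^ #|I|)%N.
    by rewrite -[_ *+ (2 ^ _)%N]mulr_natl natrX; ring.
  by rewrite -cardsT -card_powerset; apply: eq_card => X; rewrite powersetE subsetT.
rewrite exchange_big/= ler_pM2l//; apply: ler_sum => v _.
apply: (@le_trans _ _ (\sum_l 4 * - xlnx (mean v (fR l) * mean (~: v) (gR l)))).
  apply: ler_sum => l _; exact: sum_if_sqhell.
rewrite -mulr_sumr ler_pM2l// -TL; apply: sum_xlnx_ge.
  by move=> l; rewrite mulr_ge0// mean_ge0.
exact: (sum1 _ _ id id).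
Qed.

End UniqueIntersection.

(** * Degeneracy of a complete graph minus a biclique *)

Section Degeneracy.
Local Open Scope nat_scope.
Variable T : finType.

(** A vertex of [U] misses all of [V], and a set that avoids [U] has at most [#|T| - m] vertices,
    which gives the upper bound. The complement of [U] is a clique, which gives the lower one. *)
Lemma degeneracy_complete_minus_biclique (U V : {set T}) (m : nat) (g : rel T) :
  0 < m -> #|U| = m -> #|V| = m -> [disjoint U & V] ->
  (forall u v, g u v =
    (u != v) && ~~ ((u \in U) && (v \in V) || (u \in V) && (v \in U))) ->
  degeneracy g = #|T| - m - 1.
Proof.
move=> m0 Um Vm /pred0P UV gE; rewrite /degeneracy.
case: ex_minnP => k /forallP dk kmin; apply/eqP; rewrite eqn_leq.
apply/andP; split.
  apply: kmin; apply/forallP => S; apply/implyP => /set0Pn[v vS].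
  apply/existsP; have [SU|/set0Pn[u]] := eqVneq (S :&: U) set0.
    exists v; rewrite vS /=.
    have vU : v \notin U.
      apply/negP => vU; have : v \in S :&: U by rewrite !inE vS.
      by rewrite SU inE.
    have : #|~: U :\ v| = #|T| - m - 1.
      by rewrite -(cardsC U) Um addKn (cardsD1 v (~: U)) inE vU addKn.
    move=> <-; apply/subset_leq_card/fintype.subsetP => x.
    rewrite !inE gE => /andP[xS /andP[vx _]]; rewrite eq_sym vx /=.
    apply/negP => xU; have : x \in S :&: U by rewrite !inE xS.
    by rewrite SU inE.
  rewrite inE => /andP[uS uU]; exists u; rewrite uS /=.
  have uV : u \notin V by have := UV u; rewrite /= uU /= => ->.
  have : #|~: (u |: V)| = #|T| - m - 1.
    by have := cardsC (u |: V); rewrite cardsU1 uV Vm; lia.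
  move=> <-; apply/subset_leq_card/fintype.subsetP => x.
  rewrite !inE gE uU (negbTE uV) /= orbF => /andP[_ /andP[ux xV]].
  by rewrite (negbTE xV) orbF eq_sym.
have := dk (~: U); have [w wV] : exists w, w \in V.
  by apply/set0Pn; rewrite -cards_eq0 Vm -lt0n.
have wU : w \notin U by have := UV w; rewrite /= wV andbT => ->.
have -> /= : ~: U != set0 by apply/set0Pn; exists w; rewrite inE.
move=> /existsP[v /andP[vU]]; rewrite inE in vU; apply: leq_trans.
have <- : #|~: U :\ v| = #|T| - m - 1.
  by rewrite -(cardsC U) Um addKn (cardsD1 v (~: U)) inE vU addKn.
apply/subset_leq_card/fintype.subsetP => x; rewrite !inE gE => /andP[xv xU].
by rewrite (negbTE xU) (negbTE vU) eq_sym xv /= andbF.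
Qed.

Lemma coloring_collision (f : T -> nat) (k : nat) :
  (forall v, f v < k) -> k < #|T| -> exists u v, u != v /\ f u = f v.
Proof.
move=> fk kT; pose h v := Ordinal (fk v).
have /injectivePn[u [v uv]] : ~~ injectiveb h.
  by apply/injectiveP => /leq_card; rewrite card_ord leqNgt kT.
by move=> /(congr1 val) /= fuv; exists u, v.
Qed.

End Degeneracy.

(** * From set intersection to streaming colouring *)

Section Reduction.
Local Open Scope nat_scope.
Variables (n k m : nat).

(* Vertex blocks: [None] is the left side, [Some true] the right side, and
   [Some false] a copy of the right side which only serves to give Alice's
   part of the stream a length that does not depend on her input. *)
Variable emb : option bool * ('I_k * 'I_m) -> 'I_n.
Hypothesis emb_inj : injective emb.

Local Notation elt := ('I_k * 'I_k)%type.
Local Notation cell := (('I_k * 'I_m) * ('I_k * 'I_m))%type.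
Implicit Types (A B : {set elt}) (q : cell).

Definition cell_elt q : elt := (q.1.1, q.2.1).

Definition cell_pair (c : bool) q : {set 'I_n} :=
  [set emb (None, q.1); emb (Some c, q.2)].

Lemma card_cell_pair c q : #|cell_pair c q| == 2.
Proof. by rewrite /cell_pair cards2 (inj_eq emb_inj). Qed.

Lemma cell_pair_inj c c' q q' : cell_pair c q = cell_pair c' q' -> c = c' /\ q = q'.
Proof.
move=> E; case: q q' E => [x y] [x' y'] E.
have : emb (None, x) \in cell_pair c' (x', y') by rewrite -E !inE eqxx.
have : emb (Some c, y) \in cell_pair c' (x', y') by rewrite -E !inE eqxx orbT.
rewrite !inE !(inj_eq emb_inj) !xpair_eqE /= orbF => /andP[/eqP[->] /eqP ->].
by move=> /eqP ->.
Qed.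

Definition alice_edge A q : edge n :=
  exist _ (cell_pair (cell_elt q \notin A) q) (card_cell_pair _ _).

Definition alice_stream A : seq (token n) :=
  [seq (true, alice_edge A q) | q <- enum {: cell}].

Definition hole A (u : {set 'I_n}) : bool :=
  [exists q, (cell_elt q \in A) && (u == cell_pair true q)].

Definition bob_stream B : seq (token n) :=
  [seq (true, e) | e <- enum [pred e : edge n | ~~ hole B (val e)]].

Definition stream A B : seq (token n) := alice_stream A ++ bob_stream B.

Lemma size_alice_stream A : size (alice_stream A) = #|{: cell}|.
Proof. by rewrite size_map -cardE. Qed.

Lemma stream_insertion_only A B : insertion_only (stream A B).
Proof.
move=> e; apply/count_memPn; rewrite mem_cat negb_or.
by apply/andP; split; apply/mapP => -[].
Qed.

Lemma stream_at_most_twice A B : at_most_twice (stream A B).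
Proof.
move=> e; rewrite /ins count_cat -[2]/(1 + 1)%N; apply: leq_add.
  rewrite count_uniq_mem ?leq_b1// map_inj_uniq ?enum_uniq// => q q' [].
  by move=> /cell_pair_inj[].
by rewrite count_uniq_mem ?leq_b1// map_inj_uniq ?enum_uniq// => q q' [].
Qed.

(** Bob withholds only the pairs of [hole B], so he inserts all of Alice's padding edges anyway, and
    a pair of [hole B] is present exactly when Alice inserts it. *)
Lemma mem_stream A B e :
  ((true, e) \in stream A B) = ~~ hole (A :&: B) (val e).
Proof.
rewrite mem_cat; apply/orP/idP.
  case=> /mapP[].
    move=> q _ [->]; apply/existsP => -[q'] /andP[q'AB /eqP /=].
    move=> /cell_pair_inj[+ qq']; move: q'AB; rewrite -qq' inE.
    by case: (_ \in A).
  move=> e' + [->]; rewrite mem_enum inE; apply: contra.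
  move=> /existsP[q /andP[]]; rewrite inE => /andP[_ qB] qe.
  by apply/existsP; exists q; rewrite qB.
move=> he; have [/existsP[q /andP[qB /eqP qe]]|hB] := boolP (hole B (val e)).
  left; apply/mapP; exists q; first by rewrite mem_enum.
  have qA : cell_elt q \notin A.
    apply: contra he => qA; apply/existsP; exists q.
    by rewrite inE qA qB qe eqxx.
  by congr pair; apply: val_inj; rewrite /= qe qA.
by right; apply/mapP; exists e; rewrite // mem_enum.
Qed.

Lemma underlying_stream A B u v :
  underlying (stream A B) u v = (u != v) && ~~ hole (A :&: B) [set u; v].
Proof.
have multE e : (0 < mult (stream A B) e) = ~~ hole (A :&: B) (val e).
  rewrite /mult stream_insertion_only subn0 /ins -has_count has_pred1.
  exact: mem_stream.
apply/existsP/andP => [[e /andP[]]|[uv huv]].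
  rewrite multE => he /eqP uve; rewrite uve in he; split=> //.
  by have := valP e; rewrite uve cards2; case: (u != v).
have uv2 : #|[set u; v]| == 2 by rewrite cards2 uv.
by exists (exist (fun e : {set 'I_n} => #|e| == 2) _ uv2); rewrite multE /= huv eqxx.
Qed.

Lemma degeneracy_stream A B z : 0 < m -> A :&: B = [set z] ->
  degeneracy (underlying (stream A B)) = n - m - 1.
Proof.
move=> m0 ABz.
pose L a := emb (None, (z.1, a)); pose Rt b := emb (Some true, (z.2, b)).
have Linj : injective L by move=> a b /emb_inj[].
have Rinj : injective Rt by move=> a b /emb_inj[].
rewrite (@degeneracy_complete_minus_biclique _ (L @: [set: 'I_m])
  (Rt @: [set: 'I_m]) m) ?card_ord ?card_imset ?cardsT ?card_ord//.
  apply/pred0P => x /=; apply/negP => /andP[/imsetP[a _ ->] /imsetP[b _]].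
  by move=> /emb_inj.
move=> u v; rewrite underlying_stream ABz; congr (_ && ~~ _).
have eq2 x y : (x \in L @: [set: 'I_m]) && (y \in Rt @: [set: 'I_m]) ->
    hole [set z] [set x; y].
  move=> /andP[/imsetP[a _ ->] /imsetP[b _ ->]]; apply/existsP.
  by exists ((z.1, a), (z.2, b)); rewrite /cell_elt inE -surjective_pairing !eqxx.
apply/idP/idP; last first.
  by move=> /orP[/eq2//|/[1!andbC]/eq2]; rewrite setUC.
move=> /existsP[[[i a] [j b]] /andP[]]; rewrite inE /cell_elt /= => /eqP zij /eqP.
have La : emb (None, (i, a)) \in L @: [set: 'I_m].
  by apply/imsetP; exists a; rewrite // /L -zij.
have Rb : emb (Some true, (j, b)) \in Rt @: [set: 'I_m].
  by apply/imsetP; exists b; rewrite // /Rt -zij.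
move=> uvE.
have : emb (None, (i, a)) \in [set u; v] by rewrite uvE !inE eqxx.
have : emb (Some true, (j, b)) \in [set u; v] by rewrite uvE !inE eqxx orbT.
rewrite !inE => /orP[] /eqP E1 /orP[] /eqP E2.
- by move: E2; rewrite -E1 => /emb_inj.
- by rewrite -E1 -E2 La Rb orbT.
- by rewrite -E1 -E2 La Rb.
- by move: E2; rewrite -E1 => /emb_inj.
Qed.

Definition collision (f : 'I_n -> nat) : option elt :=
  [pick z : elt | [exists p : 'I_m * 'I_m,
    f (emb (None, (z.1, p.1))) == f (emb (Some true, (z.2, p.2)))]].

(** By pigeonhole two vertices share a colour; they form a non-edge, hence lie in a withheld block
    pair, so [pick] succeeds. Whatever it returns comes from a non-edge too. *)
Lemma collision_mem A B f : 0 < n ->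
  proper_coloring (underlying (stream A B)) n.-1 f ->
  exists2 z, collision f = Some z & z \in A :&: B.
Proof.
move=> n0 [fn fP]; rewrite /collision; case: pickP => [z /existsP[[a b] /eqP fab]|none].
  exists z => //; set u := emb _ in fab; set v := emb _ in fab.
  have : ~~ underlying (stream A B) u v by apply/negP => /fP.
  rewrite underlying_stream (inj_eq emb_inj) /= negbK.
  move=> /existsP[q /andP[qAB /eqP]].
  rewrite [LHS](_ : _ = cell_pair true ((z.1, a), (z.2, b)))//.
  move=> /cell_pair_inj[_ qE]; move: qAB.
  by rewrite -qE /cell_elt /= -surjective_pairing.
have [|u [v [uv fuv]]] := coloring_collision fn; first by rewrite card_ord prednK.
have : ~~ underlying (stream A B) u v by apply/negP => /fP.
rewrite underlying_stream uv /= negbK => /existsP[[[i a] [j b]] /andP[_ /eqP uvE]].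
have /negbT/existsPn/(_ (a, b))/eqP[] := none (i, j).
have : emb (None, (i, a)) \in [set u; v] by rewrite uvE !inE eqxx.
have : emb (Some true, (j, b)) \in [set u; v] by rewrite uvE !inE eqxx orbT.
by rewrite !inE /= => /orP[] /eqP -> /orP[] /eqP ->.
Qed.

Variables (W : Type) (s : nat) (alg : streaming_algorithm W n s).
Variables (w : W) (kappa : nat).

Definition run_segment (i j : nat) (st : seq (token n)) (M : s.-tuple bool) :=
  foldl (fun M jt => sa_step alg w kappa i jt.1 jt.2 M) M (zip (iota j (size st)) st).

Lemma run_pass_stream A B i M : run_pass alg w kappa (stream A B) i M =
  run_segment i #|{: cell}| (bob_stream B) (run_segment i 0 (alice_stream A) M).
Proof.
rewrite /run_pass /run_segment /stream size_cat iotaD zip_cat ?size_iota//.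
by rewrite foldl_cat add0n {2}size_alice_stream.
Qed.

(** In each pass Alice and Bob each hand over the [s] bits of memory once. Bob's tokens start at
    position [#|{: cell}|] whatever [A] is, so he can simulate his part. *)
Lemma rect_computes_memory p :
  rect_computes (fun A B => foldl (fun M i => run_pass alg w kappa (stream A B) i M)
    (sa_init alg w kappa) (iota 0 p)) (2 ^ (2 * s * p)).
Proof.
elim: p => [|p IH]; first by rewrite muln0; exact: rect_computes_cst.
have -> : iota 0 p.+1 = iota 0 p ++ [:: p] by rewrite -addn1 iotaD.
have := rect_computes_map snd
  (rect_computes_alice (fun A M => run_segment p 0 (alice_stream A) M) IH).
move=> /(rect_computes_bob (fun B M => run_segment p #|{: cell}| (bob_stream B) M)).
move=> /(rect_computes_map snd) /=.
rewrite card_tuple card_bool -!expnD -addnA addnn -mul2n addnC -mulnS.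
congr (rect_computes _ _); apply: funext => A; apply: funext => B.
by rewrite foldl_cat /= run_pass_stream.
Qed.

Definition finds_intersection p A B : bool :=
  if collision (run alg w kappa (stream A B) p) is Some z
  then (z \in A) && (z \in B) else false.

(** The two extra bits are the players' answers on whether the candidate lies in their own set; they
    rule out false positives. *)
Lemma rect_computes_finds_intersection p :
  rect_computes (finds_intersection p) (2 ^ (2 * s * p + 2)).
Proof.
pose mem_opt (A : {set elt}) (o : option elt) := if o is Some z then z \in A else false.
have := rect_computes_map (fun M => collision (sa_out alg w kappa M))
  (rect_computes_memory p).
move=> /(rect_computes_alice mem_opt).
move=> /(rect_computes_bob (fun B ob => mem_opt B ob.1)).
move=> /(rect_computes_map (fun obb => obb.1.2 && obb.2)) /=.
rewrite card_bool -mulnA -[(2 * 2)%N]/(2 ^ 2)%N -expnD.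
congr (rect_computes _ _); apply: funext => A; apply: funext => B.
by rewrite /finds_intersection /run; case: collision.
Qed.

Lemma finds_intersection_disjoint p A B :
  [disjoint A & B] -> finds_intersection p A B = false.
Proof.
move=> /pred0P AB; rewrite /finds_intersection.
by case: collision => // z; have := AB z.
Qed.

End Reduction.

(** * Averaging over the random outcome *)

Section Averaging.
Variable R : realType.

(** Integrate the pointwise bound over [w]: each indicator has integral at least [q]. This carries a
    bound for every fixed outcome over to the randomized algorithm. *)
Lemma prob_average (d : measure_display) (W : measurableType d)
    (P : probability W R) (T : finType) (c : T -> R) (E : T -> set W) (q K : R) :
  (forall t, 0 <= c t) -> (forall t, measurable (E t)) ->
  (forall t, (q%:E <= P (E t))%E) ->
  (forall w, \sum_t c t * \1_(E t) w <= K) ->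
  \sum_t c t * q <= K.
Proof.
move=> c0 mE qE cK; rewrite -lee_fin.
have -> : K%:E = (\int[P]_w (cst K%:E) w)%E.
  rewrite integral_cst; last exact: measurableT.
  by rewrite /= probability_setT mule1.
apply: (@le_trans _ _ (\int[P]_w (\sum_t ((c t)%:E * (\1_(E t) w)%:E)))%E).
  rewrite ge0_integral_sum//; last 2 first.
  - move=> t; apply: measurable_funeM; apply/measurable_EFinP.
    exact: measurable_indic.
  - by move=> t w _; rewrite lee_fin mulr_ge0.
  rewrite -sumEFin; apply: lee_sum => t _; rewrite EFinM.
  rewrite ge0_integralZl_EFin//; last first.
    by apply/measurable_EFinP; exact: measurable_indic.
  rewrite integral_indic// classical_sets.setIT.
  by apply: lee_wpmul2l; [rewrite lee_fin; exact: c0|exact: qE].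
apply: ge0_le_integral => //.
- by move=> w _; apply: sume_ge0 => t _; rewrite lee_fin mulr_ge0.
- apply: emeasurable_sum => t; apply: measurable_funeM; apply/measurable_EFinP.
  exact: measurable_indic.
- move=> w _ /=; under eq_bigr do rewrite -EFinM.
  by rewrite sumEFin lee_fin.
Qed.

Lemma le_mean (I : finType) (v : {set I}) (f g : {set I} -> R) :
  (forall X : {set I}, X \subset v -> f X <= g X) -> mean v f <= mean v g.
Proof.
by move=> fg; rewrite ler_wpM2l ?exprn_ge0 ?invr_ge0//; exact: ler_sum.
Qed.

(** Puts the nested averages into the form of one nonnegative finite combination, as [prob_average]
    requires; the weights do not depend on [h]. *)
Lemma mean_mean_linear (I : finType) :
  exists c : I * {set I} * ({set I} * {set I}) -> R,
    (forall t, 0 <= c t) /\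
    forall h : I -> {set I} -> {set I} -> R,
      \sum_i \sum_(v : {set I}) mean (v :\ i) (fun A =>
         mean (~: v :\ i) (fun B => h i A B)) =
      \sum_t c t * h t.1.1 t.2.1 t.2.2.
Proof.
exists (fun t : I * {set I} * ({set I} * {set I}) =>
  if (t.2.1 \subset t.1.2 :\ t.1.1) && (t.2.2 \subset ~: t.1.2 :\ t.1.1)
  then 2^-1 ^+ #|t.1.2 :\ t.1.1| * 2^-1 ^+ #|~: t.1.2 :\ t.1.1| else 0); split.
  by move=> t; case: ifP => // _; rewrite mulr_ge0 ?exprn_ge0 ?invr_ge0.
move=> h; rewrite pair_bigA/=.
rewrite -[RHS](pair_bigA _ (fun (iv : I * {set I}) (AB : {set I} * {set I}) =>
  (if (AB.1 \subset iv.2 :\ iv.1) && (AB.2 \subset ~: iv.2 :\ iv.1)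
  then 2^-1 ^+ #|iv.2 :\ iv.1| * 2^-1 ^+ #|~: iv.2 :\ iv.1| else 0) *
  h iv.1 AB.1 AB.2))/=.
apply: eq_bigr => -[i v] _ /=.
rewrite -[RHS](pair_bigA _ (fun A B : {set I} =>
  (if (A \subset v :\ i) && (B \subset ~: v :\ i)
  then 2^-1 ^+ #|v :\ i| * 2^-1 ^+ #|~: v :\ i| else 0) * h i A B))/=.
rewrite /mean mulr_sumr big_mkcond/=; apply: eq_bigr => A _.
case: ifP => Av /=; last by rewrite big1// => B _; rewrite mul0r.
rewrite mulrA mulr_sumr big_mkcond/=; apply: eq_bigr => B _.
by case: ifP => // _; rewrite mul0r.
Qed.

End Averaging.

(** * The space bound *)

Section LowerBound.
Local Open Scope ring_scope.
Variable R : realType.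

Lemma solves_insertion_only (d : measure_display) (W : measurableType d)
    (P : probability W R) (n s : nat) (A : streaming_algorithm W n s) p lambda :
  solves P A p lambda (@multigraph_stream n) ->
  solves P A p lambda (fun st => insertion_only st /\ at_most_twice st).
Proof.
move=> solA st [st0 _]; apply: solA => i e.
suff -> : del (take i st) e = 0%N by [].
apply/eqP; rewrite -leqn0 -(st0 e) -{2}(cat_take_drop i st) /del count_cat.
exact: leq_addr.
Qed.

Lemma block_embedding (n k m : nat) : (3 * k * m <= n)%N ->
  exists emb : option bool * ('I_k * 'I_m) -> 'I_n, injective emb.
Proof.
move=> kmn; have cardV : (#|{: option bool * ('I_k * 'I_m)}| <= n)%N.
  by rewrite !card_prod card_option card_bool !card_ord mulnA.
exists (fun x => widen_ord cardV (enum_rank x)) => x y.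
by move=> /(congr1 val) xy; apply: enum_rank_inj; exact: val_inj.
Qed.

Lemma memory_lower_bound (n k m p s : nat) (d : measure_display)
    (W : measurableType d) (P : probability W R) (A : streaming_algorithm W n s) :
  (0 < m)%N -> (0 < k)%N -> (3 * k * m <= n)%N ->
  solves P A p m (fun st => insertion_only st /\ at_most_twice st) ->
  (k * k <= 48 * (s * p) + 48)%N.
Proof.
move=> m0 k0 kmn solA; have [emb emb_inj] := block_embedding kmn.
have mn : (m < n)%N by apply: leq_trans kmn; nia.
pose I := ('I_k * 'I_k)%type.
pose good (i : I) (X Y : {set I}) := (i |: X) :&: (i |: Y) == [set i].
(* Triples that break the promise get the full event, so that the bound 2/3 holds for every index;
   they do not occur in the averages, where [X] and [Y] lie in disjoint sets. *)
pose E i X Y : set W := if good i X Y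
  then success A p m (stream emb_inj (i |: X) (i |: Y)) else classical_sets.setT.
have solE X Y : measurable (success A p m (stream emb_inj X Y)) /\
    ((2 / 3)%:E <= P (success A p m (stream emb_inj X Y)))%E.
  apply: solA; split; first exact: stream_insertion_only.
  exact: stream_at_most_twice.
have [c [c0 cE]] := mean_mean_linear R I.
pose K : R := 16 * 2 ^+ #|{: I}| * ln (2 ^ (2 * s * p + 2))%:R.
have : \sum_t c t * (2 / 3) <= K.
  apply: (@prob_average _ _ _ P _ c (fun t => E t.1.1 t.2.1 t.2.2)) => //.
  - by move=> t; rewrite /E; case: ifP => // _; exact: (solE _ _).1.
  - move=> t; rewrite /E; case: ifP => _; first exact: (solE _ _).2.
    by rewrite probability_setT lee_fin; lra.
  move=> w; rewrite -(cE (fun i X Y => \1_(E i X Y) w)).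
  (* The value [n - m - 1] is fed in for all inputs, also for disjoint sets, where it is not the
     degeneracy; there the players' check suffices. *)
  apply: le_trans (unique_intersection_bound R
    (rect_computes_finds_intersection emb_inj A w (n - m - 1) p)
    (@finds_intersection_disjoint _ _ _ _ emb_inj _ _ A w _ p)).
  apply: ler_sum => i _; apply: ler_sum => v _.
  apply: le_mean => X Xv; apply: le_mean => Y Yv.
  have XY : (i |: X) :&: (i |: Y) = [set i].
    apply/setP => x; rewrite !inE; case: eqVneq => //= xi.
    apply/negbTE/negP => /andP[/(fintype.subsetP Xv) + /(fintype.subsetP Yv)].
    by rewrite !inE => /andP[_ ->]; rewrite andbF.
  rewrite indicE ler_nat; have [|] := boolP (w \in _) => // wE.
  move: wE; rewrite in_setE /E /good XY eqxx /success /=.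
  rewrite (degeneracy_stream emb_inj m0 XY) (_ : _ + m = n.-1)%N; last by lia.
  move=> /(collision_mem (leq_ltn_trans (leq0n m) mn))[z].
  rewrite /finds_intersection => ->; rewrite inE => /andP[-> ->].
  by [].
(* A constant [h] evaluates the total weight as [k * k * 2 ^ (k * k)]. *)
rewrite -(cE (fun _ _ _ => 2 / 3)).
under eq_bigr do under eq_bigr do rewrite !mean_cst.
have sumE : \sum_(i : I) \sum_(v : {set I}) (2 / 3 : R) =
    2 ^+ #|{: I}| * ((k * k)%:R * (2 / 3)).
  rewrite !sumr_const card_prod !card_ord.
  rewrite (_ : #|_| = 2 ^ (k * k))%N; last first.
    rewrite -[(k * k)%N](_ : #|[set: I]| = _); last by rewrite cardsT card_prod !card_ord.
    by rewrite -card_powerset; apply: eq_card => X; rewrite powersetE subsetT.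
  by rewrite -[_ *+ (2 ^ _)%N]mulr_natl -[_ *+ (k * k)%N]mulr_natl natrX; ring.
rewrite {}sumE /K [16 * _]mulrC -mulrA ler_pM2l ?exprn_gt0//.
rewrite natrX lnXn// -[_ *+ (_ + _)]mulr_natr => kk.
have ln2 : ln 2 <= 1 :> R by rewrite -[2]/(1 + 1); apply: le_ln1Dx; lra.
have : ln 2 * (2 * s * p + 2)%:R <= (2 * s * p + 2)%:R :> R.
  by rewrite -[leRHS]mul1r ler_wpM2r.
rewrite -(ler_nat R); move: kk.
have -> : (48 * (s * p) + 48)%:R = 48 * (s * p)%:R + 48 :> R by rewrite natrD natrM.
have -> : (2 * s * p + 2)%:R = 2 * (s * p)%:R + 2 :> R by rewrite -mulnA natrD natrM.
lra.
Qed.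

End LowerBound.

Theorem theorem5p8 (R : realType) :
  exists (c : R) (C : nat), 0 < c /\
    forall (lambda p n : nat), (1 <= lambda)%N -> (1 <= p)%N ->
      (C * lambda <= n)%N ->
    forall (d : measure_display) (W : measurableType d) (P : probability W R)
      (s : nat) (A : streaming_algorithm W n s),
      (solves P A p lambda (@multigraph_stream n) ->
         c * (n%:R ^+ 2 / (lambda%:R ^+ 2 * p%:R)) <= s%:R) /\
      (solves P A p lambda (fun st => insertion_only st /\ at_most_twice st) ->
         c * (n%:R ^+ 2 / (lambda%:R ^+ 2 * p%:R)) <= s%:R).
Proof.
(* [n >= 100 * m] forces [k >= 33], whence [(k + 1)^2 <= 4 * (k^2 - 48) <= 4 * 48 * s * p]. As
   [n < 3 * m * (k + 1)], the constant is [9 * 4 * 48 = 1728]. *)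
exists 1728^-1, 100%N; split=> [|m p n m0 p0 mn d W P s A].
  by rewrite invr_gt0 ltr0n.
suff bound : solves P A p m (fun st => insertion_only st /\ at_most_twice st) ->
    1728^-1 * (n%:R ^+ 2 / (m%:R ^+ 2 * p%:R)) <= s%:R :> R.
  by split=> // /solves_insertion_only.
pose k := (n %/ (3 * m))%N.
have km : (3 * k * m <= n)%N by rewrite mulnAC mulnC; exact: leq_trunc_div.
have nk : (n < 3 * m * k.+1)%N by rewrite mulnC; apply: ltn_ceil; rewrite muln_gt0.
have k33 : (33 <= k)%N by rewrite leq_divRL ?muln_gt0//; lia.
move=> /(memory_lower_bound m0 (leq_trans _ k33) km) => /(_ isT) kk.
have : (n * n <= 1728 * (s * p) * (m * m))%N.
  apply: (@leq_trans ((3 * m * k.+1) * (3 * m * k.+1))).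
    by apply: leq_mul; exact: ltnW.
  rewrite (_ : _ * _ = 9 * (k.+1 * k.+1) * (m * m))%N; last by ring.
  by rewrite leq_mul2r; apply/orP; right; nia.
rewrite -(ler_nat R) !natrM => nn.
have m0R : 0 < m%:R :> R by rewrite ltr0n.
have p0R : 0 < p%:R :> R by rewrite ltr0n.
rewrite mulrA ler_pdivrMr ?mulr_gt0 ?exprn_gt0// !expr2; lra.
Qed.
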